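(* Let $C$ be a connected, positively indexed $\mathbb Z$-indexed algebra with division rings $D_i:=C_{ii}$, such that $\dim_{D_i}C_{ij}>1$ and $\dim_{D_j}C_{ij}>1$ whenever $i<j$. If a two-sided ideal $I$ of $C$ is free of rank 1 on both sides, then $I$ is generated by a normal family of elements.
   Context: A $\mathbb Z$-indexed algebra $C$ consists of abelian groups $C_{ij}$ ($i,j\in\mathbb Z$) with associative biadditive multiplications $C_{ij}\times C_{jl}\to C_{il}$ and local units $e_i\in C_{ii}$; it is identified with the ring $\bigoplus_{i,j}C_{ij}$, where the product of $C_{ij}$ and $C_{rl}$ is $0$ for $j\neq r$. Ideals are graded: $I=\bigoplus I_{ij}$, $I_{ij}=e_iIe_j$. $C$ is connected if every $C_{ii}$ is a division ring, and positively indexed if $C_{ij}=0$ for $i>j$. $\dim_{D_i}C_{ij}$ is the dimension as a left $D_i$-vector space and $\dim_{D_j}C_{ij}$ the dimension as a right $D_j$-vector space. An element $a\in C_{ij}$ is regular (a non-zero-divisor) if $ab\ne0$ and $ca\neq0$ for all non-zero $b\in e_jC$ and non-zero $c\in Ce_i$. A right ideal $I\subset C$ is free of rank 1 if there is a family of regular elements $\{a_i\in C_{i,i+\delta_i}\}_{i\in\mathbb Z}$ with $e_iI=a_iC$ for all $i$; a left ideal is free of rank 1 if there is a family of regular elements $\{b_j\in C_{j-\varepsilon_j,j}\}_{j\in\mathbb Z}$ with $Ie_j=Cb_j$ for all $j$. A family $x=\{x_i\in C_{i,i+\delta}\}_{i\in\mathbb Z}$ is a normal family of elements of degree $\delta$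 if $x_iC_{i+\delta,j+\delta}=C_{ij}x_j$ for all $i,j\in\mathbb Z$. *)

(* Defs.v *)
From HB Require Import structures.
From mathcomp Require Import all_boot all_order all_algebra.
From mathcomp Require Import boolp classical_sets functions cardinality.

Set Implicit Arguments.
Unset Strict Implicit.
Unset Printing Implicit Defensive.

Import Order.TTheory GRing.Theory Num.Theory.

Local Open Scope classical_set_scope.
Local Open Scope ring_scope.

(* As [R] may be the zero ring a priori, [1 <> 0] has to be required. *)
Definition division_ring (R : pzRingType) : Prop :=
  (1 : R) <> 0 /\
  forall x : R, x <> 0 -> exists y : R, y * x = 1 /\ x * y = 1.

Section Dimension.
Variables (R : pzRingType) (V : lmodType R).
Implicit Type B : set V.

Definition lin_indep B : Prop :=
  forall (s : seq V) (c : V -> R), uniq s -> [set` s] `<=` B ->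
    \sum_(v <- s) c v *: v = 0 -> forall v, v \in s -> c v = 0.

Definition spanning B : Prop :=
  forall w : V, exists (s : seq V) (c : V -> R),
    [set` s] `<=` B /\ w = \sum_(v <- s) c v *: v.

Definition is_basis B : Prop := lin_indep B /\ spanning B.

(* Over a division ring, where all bases have the same cardinality, this says
   that the (possibly infinite) dimension of V is larger than n. *)
Definition dim_gt (n : nat) : Prop :=
  exists B : set V, is_basis B /\ ~~ (B #<= `I_n)%card.

End Dimension.

Record zindexedAlg := ZIndexedAlg {
  zcomp :> int -> int -> zmodType;
  zmul : forall i j l, zcomp i j -> zcomp j l -> zcomp i l;
  zunit : forall i, zcomp i i;
  zmulA : forall i j l m (a : zcomp i j) (b : zcomp j l) (c : zcomp l m),
    zmul a (zmul b c) = zmul (zmul a b) c;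
  zmulDl : forall i j l (a b : zcomp i j) (c : zcomp j l),
    zmul (a + b) c = zmul a c + zmul b c;
  zmulDr : forall i j l (a : zcomp i j) (b c : zcomp j l),
    zmul a (b + c) = zmul a b + zmul a c;
  zmul1l : forall i j (a : zcomp i j), zmul (zunit i) a = a;
  zmul1r : forall i j (a : zcomp i j), zmul a (zunit j) = a
}.

Arguments zmul {z i j l}.
Arguments zunit {z}.

(* The ring D_i = C_ii, and C_ij as a left D_i-module and as a right
   D_j-module, i.e. as a left module over the converse ring of D_j. *)
Definition diag (C : zindexedAlg) (i : int) : Type := C i i.
Definition lcomp (C : zindexedAlg) (i j : int) : Type := C i j.
Definition rcomp (C : zindexedAlg) (i j : int) : Type := C i j.

Section Modules.
Variables (C : zindexedAlg) (i j : int).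

HB.instance Definition _ := GRing.Zmodule.copy (diag C i) (C i i).
HB.instance Definition _ := GRing.Zmodule.copy (lcomp C i j) (C i j).
HB.instance Definition _ := GRing.Zmodule.copy (rcomp C i j) (C i j).

HB.instance Definition _ := GRing.Zmodule_isPzRing.Build (diag C i)
  (fun a b c => @zmulA C i i i i a b c)
  (fun a => @zmul1l C i i a) (fun a => @zmul1r C i i a)
  (fun a b c => @zmulDl C i i i a b c) (fun a b c => @zmulDr C i i i a b c).

HB.instance Definition _ :=
  GRing.Zmodule_isLmodule.Build (diag C i) (lcomp C i j)
    (fun a b v => @zmulA C i i i j a b v)
    (fun v => @zmul1l C i j v)
    (fun a u v => @zmulDr C i i j a u v)
    (fun v a b => @zmulDl C i i j a b v).

End Modules.

Section RightModule.
Variables (C : zindexedAlg) (i j : int).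

Definition rscale (a : (diag C j)^c) (v : rcomp C i j) : rcomp C i j :=
  @zmul C i j j v a.

Lemma rscaleA a b v : rscale a (rscale b v) = rscale (a * b) v.
Proof. by rewrite /rscale -zmulA. Qed.

Lemma rscale1 : left_id 1 rscale.
Proof. by move=> v; exact: zmul1r. Qed.

Lemma rscaleDr : right_distributive rscale +%R.
Proof. by move=> a u v; exact: zmulDl. Qed.

Lemma rscaleDl v : {morph rscale^~ v : a b / a + b}.
Proof. by move=> a b; exact: zmulDr. Qed.

HB.instance Definition _ :=
  GRing.Zmodule_isLmodule.Build (diag C j)^c (rcomp C i j)
    rscaleA rscale1 rscaleDr rscaleDl.

End RightModule.

Definition zconnected (C : zindexedAlg) : Prop :=
  forall i, division_ring (diag C i).

Definition positively_indexed (C : zindexedAlg) : Prop :=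
  forall i j, (j < i)%R -> forall a : C i j, a = 0.

(* A homogeneous element multiplies the elements of e_j C and C e_i component
   by component, so that it suffices to test it on homogeneous elements. *)
Definition regular (C : zindexedAlg) (i j : int) (a : C i j) : Prop :=
  (forall l (b : C j l), b <> 0 -> zmul a b <> 0) /\
  (forall l (c : C l i), c <> 0 -> zmul c a <> 0).

(* A graded ideal I is given by its components I_ij = e_i I e_j. *)
Record two_sided_ideal (C : zindexedAlg) (I : forall i j, set (C i j)) : Prop :=
  TwoSidedIdeal {
    ideal0 : forall i j, I i j 0;
    idealB : forall i j (a b : C i j), I i j a -> I i j b -> I i j (a - b);
    idealMl : forall i j l (c : C i j) (a : C j l), I j l a -> I i l (zmul c a);
    idealMr : forall i j l (a : C i j) (c : C j l), I i j a -> I i l (zmul a c)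
  }.

Definition right_free_rank1 (C : zindexedAlg) (I : forall i j, set (C i j)) :
    Prop :=
  exists (d : int -> int) (a : forall i, C i (i + d i)),
    (forall i, regular (a i)) /\
    forall i j, I i j = range (fun c : C (i + d i) j => zmul (a i) c).

Definition left_free_rank1 (C : zindexedAlg) (I : forall i j, set (C i j)) :
    Prop :=
  exists (e : int -> int) (b : forall j, C (j - e j) j),
    (forall j, regular (b j)) /\
    forall i j, I i j = range (fun c : C i (j - e j) => zmul c (b j)).

Definition normal_family (C : zindexedAlg) (d : int)
    (x : forall i, C i (i + d)) : Prop :=
  forall i j, range (fun c : C (i + d) (j + d) => zmul (x i) c) =
              range (fun c : C i j => zmul c (x j)).

Definition generated_ideal (C : zindexedAlg) (d : int)
    (x : forall i, C i (i + d)) (i j : int) : set (C i j) :=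
  [set y | forall J : forall i j, set (C i j),
     two_sided_ideal J -> (forall k, J k (k + d) (x k)) -> J i j y].

Arguments generated_ideal {C d} x i j.

(* Main.v *)
(** Write [e_i I = a_i C] with [a_i] in [C_{i,f(i)}] and [I e_j = C b_j] with
    [b_j] in [C_{g(j),j}].  Since [C_{ij} <> 0] exactly when [i <= j], the
    component [I_{ij}] is non-zero iff [f(i) <= j] iff [i <= g(j)]: the maps
    [f] and [g] form a Galois connection.  If [i < k := g(f(i))], then, with
    [j := f(i) = f(k)], [I_{ij} = a_i D_j = C_{ik} b_j] while
    [I_{kj} = a_k D_j = D_k b_j], so that [b_j D_j] lies in [D_k b_j]; writing
    [a_i = c b_j] and cancelling [b_j] gives [C_{ik} = c D_k], against the
    hypothesis on dimensions.  So [g \o f = id], dually [f \o g = id], and an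
    order automorphism of the integers is a translation by some [d].  Then
    [a_i] and [b_{i+d}] differ by a unit of [D_i], so [a] is normal. *)
Require Import Defs.
From mathcomp Require Import all_boot all_order all_algebra.
From mathcomp Require Import boolp classical_sets functions cardinality.
From mathcomp Require Import zify.

Set Implicit Arguments.
Unset Strict Implicit.
Unset Printing Implicit Defensive.

Import Order.TTheory GRing.Theory Num.Theory.

Local Open Scope classical_set_scope.
Local Open Scope ring_scope.

(** A basis with more than one element contains some [u != 0] and some [w != u]. If both were
    multiples of [v], then [w] would be a multiple of [u], a linear dependence inside the basis. *)
Lemma dim_gt1_not_line (R : pzRingType) (V : lmodType R) :
  division_ring R -> dim_gt V 1 ->
  forall v : V, exists w : V, forall x : R, w <> x *: v.
Proof.
move=> [R10 Rinv] [B [[Bfree _] Bcard]] v; apply: contrapT => noline.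
have line w : exists x : R, w = x *: v.
  apply: contrapT => nx; apply: noline; exists w => x wE.
  by apply: nx; exists x.
have other u : exists2 w, B w & w != u.
  apply: contrapT => Bu; move/negP: Bcard; apply.
  suff sBu : B `<=` [set u].
    by rewrite -(card_le_eqr (card_set1 (x := u))); exact: subset_card_le.
  move=> w Bw /=; apply: contrapT => wu; apply: Bu; exists w => //.
  exact/eqP.
have [u Bu u0] := other 0; have [w Bw wu] := other u.
have [x uE] := line u; have [y wE] := line w.
have x0 : x <> 0 by move=> x0; move: u0; rewrite uE x0 scale0r eqxx.
have [z [zx _]] := Rinv x x0.
(* The coefficients of the relation [(y * z) *: u - w = 0], where [z * x = 1]. *)
pose c t : R := if t == u then y * z else -1.
have : c w = 0.
  apply: (Bfree [:: u; w] c); rewrite ?inE ?eqxx ?orbT //=.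
  - by rewrite inE eq_sym wu.
  - by move=> t; rewrite /= !inE => /orP[] /eqP ->.
  rewrite !big_cons big_nil addr0 /c eqxx (negbTE wu) scaleN1r.
  by rewrite [in X in X - _]uE scalerA -mulrA zx mulr1 wE subrr.
by rewrite /c (negbTE wu) => /eqP; rewrite oppr_eq0 => /eqP.
Qed.

Section ZIndexedAlgebra.
Variable C : zindexedAlg.

Lemma zmul0l i j l (b : C j l) : zmul (0 : C i j) b = 0.
Proof. by apply: (addrI (zmul 0 b)); rewrite -zmulDl !addr0. Qed.

Lemma zmul0r i j l (a : C i j) : zmul a (0 : C j l) = 0.
Proof. by apply: (addrI (zmul a 0)); rewrite -zmulDr !addr0. Qed.

Lemma zmulNl i j l (a : C i j) (b : C j l) : zmul (- a) b = - zmul a b.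
Proof. by apply: (addrI (zmul a b)); rewrite -zmulDl !subrr zmul0l. Qed.

Lemma zmulNr i j l (a : C i j) (b : C j l) : zmul a (- b) = - zmul a b.
Proof. by apply: (addrI (zmul a b)); rewrite -zmulDr !subrr zmul0r. Qed.

Lemma regular_cancell i j (a : C i j) l (b c : C j l) :
  regular a -> zmul a b = zmul a c -> b = c.
Proof.
move=> [ra _] abac; apply: contrapT => bc; apply: (ra l (b - c)).
  by move/eqP; rewrite subr_eq0 => /eqP.
by rewrite zmulDr zmulNr abac subrr.
Qed.

Lemma regular_cancelr i j (a : C i j) l (b c : C l i) :
  regular a -> zmul b a = zmul c a -> b = c.
Proof.
move=> [_ ra] baca; apply: contrapT => bc; apply: (ra l (b - c)).
  by move/eqP; rewrite subr_eq0 => /eqP.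
by rewrite zmulDl zmulNl baca subrr.
Qed.

Section Dimension.
Hypotheses (hconn : zconnected C) (hpos : positively_indexed C).
Hypothesis hdiml : forall i j : int, i < j -> dim_gt (lcomp C i j) 1%N.
Hypothesis hdimr : forall i j : int, i < j -> dim_gt (rcomp C i j) 1%N.

Lemma lcomp_not_line i j (v : C i j) : i < j ->
  exists w : C i j, forall x : C i i, w <> zmul x v.
Proof. by move=> ij; exact: (dim_gt1_not_line (hconn i) (hdiml ij) v). Qed.

Lemma rcomp_not_line i j (v : C i j) : i < j ->
  exists w : C i j, forall x : C j j, w <> zmul v x.
Proof.
move=> ij.
suff dj : division_ring (diag C j)^c.
  exact: (dim_gt1_not_line dj (hdimr ij) v).
have [j10 jinv] := hconn j; split=> // x /jinv[y [yx xy]].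
by exists y.
Qed.

Lemma zcomp_neq0 i j : i <= j -> exists c : C i j, c <> 0.
Proof.
rewrite le_eqVlt => /orP[/eqP <-|ij]; first by exists (zunit i); case: (hconn i).
have [w hw] := lcomp_not_line (0 : C i j) ij.
by exists w => w0; apply: (hw 0); rewrite w0 zmul0l.
Qed.

Lemma zcomp_le i j (c : C i j) : c <> 0 -> i <= j.
Proof. by move=> c0; rewrite leNgt; apply/negP => /(hpos)/(_ c). Qed.

Section FreeIdeal.
Variables (I : forall i j : int, set (C i j)) (f g : int -> int).
Arguments I : clear implicits.
Variables (a : forall i, C i (f i)) (b : forall j, C (g j) j).
Hypotheses (ra : forall i, regular (a i)) (rb : forall j, regular (b j)).
Hypothesis IaE : forall i j, I i j = range (fun c : C (f i) j => zmul (a i) c).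
Hypothesis IbE : forall i j, I i j = range (fun c : C i (g j) => zmul c (b j)).

Lemma ideal_left i j (c : C (f i) j) : exists c', zmul (a i) c = zmul c' (b j).
Proof.
have : I i j (zmul (a i) c) by rewrite IaE; exists c.
by rewrite IbE => -[c' _ <-]; exists c'.
Qed.

Lemma ideal_right i j (c : C i (g j)) : exists c', zmul c (b j) = zmul (a i) c'.
Proof.
have : I i j (zmul c (b j)) by rewrite IbE; exists c.
by rewrite IaE => -[c' _ <-]; exists c'.
Qed.

(** By regularity, a non-zero [c] in [C (f i) j] yields a non-zero element
    [zmul (a i) c = zmul c' (b j)] of [I i j], hence a non-zero [c'] in [C i (g j)]; the converse is
    symmetric. *)
Lemma galois_connection i j : (f i <= j) = (i <= g j).
Proof.
apply/idP/idP => [/zcomp_neq0[c c0]|/zcomp_neq0[c c0]].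
  have [c' e] := ideal_left c; apply: (zcomp_le (c := c')) => c'0.
  by apply: (proj1 (ra i) _ _ c0); rewrite e c'0 zmul0l.
have [c' e] := ideal_right c; apply: (zcomp_le (c := c')) => c'0.
by apply: (proj2 (rb j) _ _ c0); rewrite e c'0 zmul0r.
Qed.

(** Destructing the equality of indices retypes [a i] as an element of [C i j], so that no transport
    along [f i = j] enters later computations; [left_generator] does the same for [b j]. *)
Lemma right_generator i j : f i = j ->
  exists a' : C i j,
    forall l, I i l = range (fun c : C j l => zmul a' c).
Proof. by move=> <-; exists (a i). Qed.

Lemma left_generator j k : g j = k ->
  exists b' : C k j,
    forall i, I i j = range (fun c : C i k => zmul c b').
Proof. by move=> <-; exists (b j). Qed.

Lemma right_generator_in i : I i (f i) (a i).
Proof. by rewrite IaE; exists (zunit _); rewrite ?zmul1r. Qed.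

Lemma left_generator_in j : I (g j) j (b j).
Proof. by rewrite IbE; exists (zunit _); rewrite ?zmul1l. Qed.

Lemma galois_unit i : i <= g (f i).
Proof. by rewrite -galois_connection. Qed.

Lemma galois_counit j : f (g j) <= j.
Proof. by rewrite galois_connection. Qed.

Lemma galois_homo i k : i <= k -> f i <= f k.
Proof. by move=> ik; rewrite galois_connection (le_trans ik) ?galois_unit. Qed.

Lemma galois_unit_id i : g (f i) = i.
Proof.
apply/eqP; rewrite eq_le galois_unit andbT leNgt; apply/negP => ik.
have fk : f (g (f i)) = f i.
  by apply/eqP; rewrite eq_le galois_counit galois_homo ?galois_unit.
have [a2 Ia2] := right_generator fk.
have [c _ aE] : range (fun c => zmul c (b (f i))) (a i).
  by rewrite -IbE; exact: right_generator_in.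
have [u _ bE] : range (fun u => zmul a2 u) (b (f i)).
  by rewrite -Ia2; exact: left_generator_in.
(* With [b] for [b (f i)], the contradiction is [w b = a_i x = c b x = c a2 u x = c y b], whence
   [w = c y]; the factor [a2 u x] becomes [y b] because it lies in the ideal. *)
have [w hw] := rcomp_not_line c ik.
have [x wE] := ideal_right w.
have [y _ yE] : range (fun y => zmul y (b (f i))) (zmul a2 (zmul u x)).
  by rewrite -IbE Ia2; exists (zmul u x).
apply: (hw y); apply: (regular_cancelr (rb (f i))).
by rewrite wE -aE -bE -!zmulA bE yE.
Qed.

(** The mirror image of [galois_unit_id], using left dimensions. That lemma, applied at [g j], lets
    [b2], the generator at [f (g j)], start in degree [g j]; then
    [a w = x b_j = x a c = x u b2 c = a y c] with [a] for [a (g j)]. *)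
Lemma galois_counit_id j : f (g j) = j.
Proof.
apply/eqP; rewrite eq_le galois_counit /= leNgt; apply/negP => kj.
have [b2 Ib2] := left_generator (galois_unit_id (g j)).
have [c _ bE] : range (fun c => zmul (a (g j)) c) (b j).
  by rewrite -IaE; exact: left_generator_in.
have [u _ aE] : range (fun u => zmul u b2) (a (g j)).
  by rewrite -Ib2; exact: right_generator_in.
have [w hw] := lcomp_not_line c kj.
have [x wE] := ideal_left w.
have [y _ yE] : range (fun y => zmul (a (g j)) y) (zmul (zmul x u) b2).
  by rewrite -IaE Ib2; exists (zmul x u).
apply: (hw y); apply: (regular_cancell (ra (g j))).
by rewrite wE -bE !zmulA yE -aE !zmulA.
Qed.

(** The connection gives each inequality up to one unit; the remaining case of equality is excluded
    because [f] and [g] are mutually inverse. *)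
Lemma galois_succ i : f (i + 1) = f i + 1.
Proof.
apply/eqP; rewrite eq_le; apply/andP; split.
  have : i <= g (f i + 1) by rewrite -galois_connection; lia.
  rewrite galois_connection; case: (ltgtP i (g (f i + 1))) => [||e]; [lia|lia|].
  by move: (galois_counit_id (f i + 1)); rewrite -e; lia.
have : f i <= f (i + 1) by apply: galois_homo; lia.
case: (ltgtP (f i) (f (i + 1))) => [||e]; [lia|lia|].
by have := galois_unit_id (i + 1); rewrite -e galois_unit_id; lia.
Qed.

Lemma galois_translation i : f i = i + f 0.
Proof.
elim/int_rec: i => [|n IHn|n IHn]; first by rewrite add0r.
  by rewrite -addn1 PoszD galois_succ IHn; lia.
by have := galois_succ (- n.+1%:Z); rewrite (_ : - _ + 1 = - n%:Z) ?IHn; lia.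
Qed.

End FreeIdeal.

(** The left generator [b'] at [j + d] starts in degree [j], so [a j = zmul u b'] with [u] in [D_j].
    As [a j] is non-zero, [u] is invertible, and [a j] and [b'] have the same left multiples. *)
Lemma normal_family_of_free_ideal (I : forall i j, set (C i j)) (d : int)
    (a : forall i, C i (i + d)) (e : int -> int) (b : forall j, C (j - e j) j) :
  (forall i j, I i j = range (fun c : C (i + d) j => zmul (a i) c)) ->
  (forall i j, I i j = range (fun c : C i (j - e j) => zmul c (b j))) ->
  (forall i, i + d - e (i + d) = i) -> (forall i, regular (a i)) ->
  normal_family a.
Proof.
move=> IaE IbE ge ra i j; rewrite -IaE.
have [b' Ib'] := left_generator IbE (ge j).
have [u _ aE] : range (fun u => zmul u b') (a j).
  by rewrite -Ib' IaE; exists (zunit _); rewrite ?zmul1r.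
have [v [vu uv]] : exists v : C j j, zmul v u = zunit j /\ zmul u v = zunit j.
  apply: (proj2 (hconn j)) => u0.
  apply: (proj1 (ra j) _ (zunit (j + d))); first by case: (hconn (j + d)).
  by rewrite zmul1r -aE u0 zmul0l.
rewrite Ib'; apply/seteqP; split => [_ [c _ <-]|_ [c _ <-]].
  by exists (zmul c v) => //; rewrite -aE zmulA -(zmulA c) vu zmul1r.
by exists (zmul c u) => //; rewrite -zmulA aE.
Qed.

End Dimension.

Lemma generated_idealE (I : forall i j, set (C i j)) (d : int)
    (a : forall i, C i (i + d)) :
  two_sided_ideal I ->
  (forall i j, I i j = range (fun c : C (i + d) j => zmul (a i) c)) ->
  forall i j, I i j = generated_ideal a i j.
Proof.
move=> hI IaE i j; apply/seteqP; split => [y|y]; last first.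
  apply=> // k; rewrite IaE; exists (zunit _) => //; exact: zmul1r.
rewrite IaE => -[c _ <-] J hJ Ja.
by apply: (Defs.idealMr hJ); exact: Ja.
Qed.

End ZIndexedAlgebra.

Theorem theorem4p7 (C : zindexedAlg)
  (hconn : zconnected C) (hpos : positively_indexed C)
  (hdiml : forall i j : int, i < j -> dim_gt (lcomp C i j) 1%N)
  (hdimr : forall i j : int, i < j -> dim_gt (rcomp C i j) 1%N)
  (I : forall i j : int, set (C i j))
  (hI : two_sided_ideal I)
  (hr : right_free_rank1 I) (hl : left_free_rank1 I) :
  exists (d : int) (x : forall i : int, C i (i + d)),
    normal_family x /\ forall i j : int, I i j = generated_ideal x i j.
Proof.
have [d [a [ra IaE]]] := hr; have [e [b [rb IbE]]] := hl.
have gf i := galois_unit_id hconn hpos hdiml hdimr ra rb IaE IbE i.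
have dE : d = fun=> d 0.
  apply/funext => i.
  have := galois_translation hconn hpos hdiml hdimr ra rb IaE IbE i.
  by rewrite add0r => /addrI.
(* Once [d] is replaced by a constant function, [a] itself has the type of a family of fixed degree
   [d0]. *)
move: (d 0) dE => d0 dE; subst d.
exists d0, a; split; last exact: generated_idealE.
exact: (normal_family_of_free_ideal hconn IaE IbE).
Qed.
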